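(* Let $(X,d)$ be a compact metric space, let $f_{1,\infty}=(f_n)_{n=1}^\infty$ be a sequence of feeble open continuous maps $f_n:X\to X$, and let $f:X\to X$ be a continuous map such that every $f_n$ commutes with $f$ (that is, $f_n\circ f=f\circ f_n$ for all $n\in\mathbb{N}$) and $\sum_{i=1}^\infty D(f_i,f)<\infty$. Let $\mathcal{F}$ be a filterdual and translation invariant Furstenberg family. Then the autonomous system $(X,f)$ is $\mathcal{F}$-transitive if and only if the non-autonomous system $(X,f_{1,\infty})$ is $\mathcal{F}$-transitive.
   Context: A non-autonomous discrete dynamical system (N.D.S.) $(X,f_{1,\infty})$ consists of a compact metric space $(X,d)$ and a sequence $f_{1,\infty}=(f_n)_{n=1}^\infty$ of continuous maps $f_n:X\to X$. Put $f_1^n=f_n\circ f_{n-1}\circ\cdots\circ f_1$. The autonomous system $(X,f)$ is the case where all maps equal $f$, so $f_1^n=f^n$. The supremum metric on the set $C(X)$ of continuous self-maps of $X$ is $D(f,g)=\sup_{x\in X} d(f(x),g(x))$. The system $(X,f_{1,\infty})$ is generated by feeble open maps if for every non-empty open $U\subseteq X$ and every $n\in\mathbb{N}$, the interior of $f_n(U)$ is non-empty. For open sets $U,V\subseteq X$, $N_{f_{1,\infty}}(U,V)=\{n\in\mathbb{N}: f_1^n(U)\cap V\neq\emptyset\}$ (and $N_f(U,V)=\{n\in\mathbb{N}: f^n(U)\cap V\neq\emptyset\}$ for an autonomous system). Let $\mathcal{P}$ be the collection of all subsets of $\mathbb{Z}^+$. A Furstenberg family is a collection $\mathcal{F}\subseteq\mathcal{P}$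 that is hereditary upwards: $F_1\subset F_2$ and $F_1\in\mathcal{F}$ imply $F_2\in\mathcal{F}$. All Furstenberg families are assumed proper, i.e. $\mathcal{F}\neq\mathcal{P}$. The dual family is $k\mathcal{F}=\{F\in\mathcal{P}: F\cap F'\neq\emptyset \text{ for all } F'\in\mathcal{F}\}$. For Furstenberg families $\mathcal{F}_1,\mathcal{F}_2$, put $\mathcal{F}_1\cdot\mathcal{F}_2=\{F_1\cap F_2: F_1\in\mathcal{F}_1, F_2\in\mathcal{F}_2\}$. $\mathcal{F}$ is filterdual if it is proper and $k\mathcal{F}\cdot k\mathcal{F}\subseteq k\mathcal{F}$. $\mathcal{F}$ is translation invariant if for every $F\in\mathcal{F}$ and every $i\in\mathbb{Z}^+$, $F+i\in\mathcal{F}$ and $F-i\in\mathcal{F}$ (where $F+i=\{n+i:n\in F\}$ and $F-i=\{n-i:n\in F\}\cap\mathbb{Z}^+$). The system $(X,f_{1,\infty})$ is $\mathcal{F}$-transitive if for any two non-empty open sets $U,V\subseteq X$, $N_{f_{1,\infty}}(U,V)=\{n\in\mathbb{N}: f_1^n(U)\cap V\neq\emptyset\}\in\mathcal{F}$; the autonomous system $(X,f)$ is $\mathcal{F}$-transitive if for any two non-empty open sets $U,V\subseteq X$, $N_f(U,V)=\{n\in\mathbb{N}: f^n(U)\cap V\neq\emptyset\}\in\mathcal{F}$. *)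

(* Defs.v *)
From HB Require Import structures.
From mathcomp Require Import all_boot all_order all_algebra.
From mathcomp Require Import all_classical all_reals all_analysis.

Set Implicit Arguments.
Unset Strict Implicit.
Unset Printing Implicit Defensive.

Import Order.TTheory GRing.Theory Num.Theory.

Local Open Scope classical_set_scope.
Local Open Scope ring_scope.

(* N and Z^+ both denote the positive integers, so hitting times start at 1. *)
Definition Zplus : set nat := [set n | (0 < n)%N].

Definition subsets_Zplus : set (set nat) := [set A | A `<=` Zplus].

Definition proper_family (F : set (set nat)) : Prop := F <> subsets_Zplus.

Definition furstenberg_family (F : set (set nat)) : Prop :=
  [/\ F `<=` subsets_Zplus,
      forall A B : set nat,
        subsets_Zplus B -> A `<=` B -> F A -> F B
    & proper_family F].

Definition dual_family (F : set (set nat)) : set (set nat) :=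
  [set A | subsets_Zplus A /\ forall B, F B -> A `&` B !=set0].

Definition mul_family (F G : set (set nat)) : set (set nat) :=
  [set A `&` B | A in F & B in G].

Definition filterdual (F : set (set nat)) : Prop :=
  proper_family F /\
  mul_family (dual_family F) (dual_family F) `<=` dual_family F.

Definition shift_right (A : set nat) (i : nat) : set nat :=
  [set (n + i)%N | n in A].

(* Subtraction on nat is truncated; every n <= i is sent to 0, which the
   intersection with Zplus discards. *)
Definition shift_left (A : set nat) (i : nat) : set nat :=
  [set (n - i)%N | n in A] `&` Zplus.

Definition translation_invariant (F : set (set nat)) : Prop :=
  forall A i, F A -> Zplus i -> F (shift_right A i) /\ F (shift_left A i).

Definition sup_dist (R : realType) (X : metricType R) (f g : X -> X) : R :=
  sup (range (fun x => mdist (f x) (g x))).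

(* A sequence (f_n)_{n >= 1} of maps is a function on nat whose value at 0 is
   never used. *)
Fixpoint nds_iter (X : Type) (f_ : nat -> X -> X) (n : nat) : X -> X :=
  if n is m.+1 then f_ m.+1 \o nds_iter f_ m else id.

Definition feeble_open_seq (X : topologicalType) (f_ : nat -> X -> X) : Prop :=
  forall (U : set X) (n : nat), open U -> U !=set0 -> Zplus n ->
    interior (f_ n @` U) !=set0.

Definition nds_hitting_times (X : Type) (f_ : nat -> X -> X) (U V : set X) :
    set nat :=
  [set n | Zplus n /\ (nds_iter f_ n @` U) `&` V !=set0].

Definition hitting_times (X : Type) (f : X -> X) (U V : set X) : set nat :=
  [set n | Zplus n /\ (iter n f @` U) `&` V !=set0].

Definition nds_transitive (X : topologicalType) (F : set (set nat))
    (f_ : nat -> X -> X) : Prop :=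
  forall U V : set X, open U -> open V -> U !=set0 -> V !=set0 ->
    F (nds_hitting_times f_ U V).

Definition ads_transitive (X : topologicalType) (F : set (set nat))
    (f : X -> X) : Prop :=
  forall U V : set X, open U -> open V -> U !=set0 -> V !=set0 ->
    F (hitting_times f U V).

(* Main.v *)
Require Import Defs.
From HB Require Import structures.
From mathcomp Require Import all_boot all_order all_algebra.
From mathcomp Require Import all_classical all_reals all_analysis.

(** Write [f_1^n] for [nds_iter f_ n] and [e_n] for the tail
    [D(f_(n+1), f) + D(f_(n+2), f) + ...], which tends to [0].  Because [f]
    commutes with every [f_i], the maps [f_(n+k) \o ... \o f_(n+1)] and [f^k]
    can be compared by exchanging one factor at a time, each factor being
    moved to the outermost position before it is exchanged.  The exchange of
    [f_i] for [f] then costs at most [D(f_i, f)], with no Lipschitz condition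
    on the maps, so that
      [d(f_1^(n+k) u, f^k (f_1^n u)) <= D(f_(n+1), f) + ... + D(f_(n+k), f)],
    which is at most [e_n], uniformly in [u] and [k]
    ([mdist_nds_iter_shift], [nds_iter_shadow]).  Up to a small error, the
    non-autonomous orbit of [u] is thus, from time [n] on, the [f]-orbit of
    [f_1^n u].

    Let [U] and [V] be non-empty and open, and let [W] be a ball in [V] whose
    points stay in [V] when moved by less than [e], where [e_n < e].

    If [f] is transitive, then [f_1^n U] contains a non-empty open set [U'] by
    feeble openness, and every time at which [f] carries [U'] into [W] gives,
    when [n] is added, a time at which the sequence carries [U] into [V].  So
    the latter times contain a right translate of a member of the family.

    If the sequence is transitive, then there is [m >= n] for which the
    preimage [U'] of [U] under [f_1^m] is non-empty.  Indeed the times at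
    which [X] meets [U] form a member of the family, and members are infinite:
    left translates of members are members, and the empty set is not one since
    the family is proper ([translation_invariant_unbounded]).  Every time
    [m + k] at which the sequence carries [U'] into [W] gives a time [k] at
    which [f] carries [U] into [V].  So the latter times contain a left
    translate of a member of the family. *)

Set Implicit Arguments.
Unset Strict Implicit.
Unset Printing Implicit Defensive.

Import Order.TTheory GRing.Theory Num.Theory.

Local Open Scope classical_set_scope.
Local Open Scope ring_scope.

(** * Furstenberg families *)

Lemma furstenberg_family_neq0 (F : set (set nat)) (A : set nat) :
  furstenberg_family F -> F A -> A !=set0.
Proof.
move=> [Fsub Fup Fproper] FA; apply/set0P/eqP => A0; apply: Fproper.
apply/seteqP; split=> // B BZ; apply: Fup BZ _ FA.
by rewrite A0.
Qed.

(** If [A] stopped before [m], its left translate by [m] would be an empty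
    member of the family. *)
Lemma translation_invariant_unbounded (F : set (set nat)) (A : set nat) m :
  furstenberg_family F -> translation_invariant F -> F A ->
  exists2 n, A n & (m < n)%N.
Proof.
move=> Ffam Ftr FA.
have [_ FAm] := Ftr A m.+1 FA isT.
have [_ [[n An <-]]] := furstenberg_family_neq0 Ffam FAm.
rewrite /Zplus /= subn_gt0 => mn.
by exists n => //; exact: ltnW.
Qed.

(** * The supremum distance on a compact space *)

Section sup_dist_theory.
Context {R : realType} {X : metricType R}.
Implicit Types g h : X -> X.

(** Compactness enters as near covering: near each [x] a bound slightly above
    [mdist x0 x] works, so one bound works for all points. *)
Lemma compact_mdist_bounded (x0 : X) :
  compact [set: X] -> exists M, forall x, mdist x0 x < M.
Proof.
move=> /compact_near_coveringP cX.
have : \forall M \near +oo%R, [set: X] `<=` [set x | mdist x0 x < M].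
  apply: cX => x _.
  exists (ball x 1, [set M | mdist x0 x + 1 < M]).
    by split; [exact: nbhsx_ballx | apply: nbhs_pinfty_gt; exact: num_real].
  move=> [y M] /= [xy xM]; apply: le_lt_trans (metric_triangle x0 x y) _.
  apply: lt_trans xM; rewrite ltrD2l.
  by move: xy; rewrite ballEmdist.
move=> [M [_ MP]]; exists (M + 1) => x.
by apply: (MP (M + 1)) => //; rewrite ltrDl.
Qed.

Lemma mdist_le_sup_dist g h x :
  compact [set: X] -> mdist (g x) (h x) <= sup_dist g h.
Proof.
move=> cX; apply: ub_le_sup; last by exists x.
have [M MP] := compact_mdist_bounded x cX.
exists (M + M) => _ [y _ <-].
apply: le_trans (metric_triangle _ x _) _.
by rewrite (metric_sym (g y)) ltW// ltrD.
Qed.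

Lemma sup_dist_ge0 g h : 0 <= sup_dist g h.
Proof.
(* [sup] defaults to [0] on a set that has no supremum. *)
rewrite /sup_dist; set D := (X in sup X).
have [[[_ [x _ _]] ubD]|/sup_out -> //] := pselect (has_sup D).
by apply: le_trans (mdist_ge0 (g x) (h x)) _; apply: ub_le_sup => //; exists x.
Qed.

End sup_dist_theory.

(** * Iterates of a non-autonomous system *)

Lemma iter_comm (T : Type) (g h : T -> T) k :
  g \o h = h \o g -> g \o iter k h = iter k h \o g.
Proof.
move=> gh; apply/funext => x /=; elim: k => //= k <-.
by have := congr1 (fun F => F (iter k h x)) gh.
Qed.

Section nds_iter_theory.
Context {R : realType} {X : metricType R}.
Variables (f_ : nat -> X -> X) (f : X -> X).

Lemma nds_iter_continuous n :
  (forall i, Zplus i -> continuous (f_ i)) -> continuous (nds_iter f_ n).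
Proof.
move=> f_cont; elim: n => [|n IHn] x /=; first exact: cvg_id.
by apply: continuous_comp; [exact: IHn | exact: f_cont].
Qed.

Lemma nds_iter_feeble_open n (U : set X) :
  feeble_open_seq f_ -> open U -> U !=set0 ->
  interior (nds_iter f_ n @` U) !=set0.
Proof.
move=> f_feeble oU U0; elim: n => [|n IHn] /=.
  by rewrite image_id; move/interior_id: oU => ->.
have := f_feeble _ n.+1 (@open_interior _ _) IHn isT.
apply: subset_nonempty; apply: interiorS.
by rewrite -image_comp; apply: image_subset; exact: interior_subset.
Qed.

(** The step peels off the first map after time [n] rather than the last one:
    comparing [f_(n+1)] with [f] at the point [f^k (f_1^n u)] uses the
    commutation with [f], and the remaining [k] maps are the same claim
    at time [n + 1]. *)
Lemma mdist_nds_iter_shift n k u :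
  compact [set: X] ->
  (forall i, Zplus i -> f_ i \o f = f \o f_ i) ->
  mdist (nds_iter f_ (n + k)%N u) (iter k f (nds_iter f_ n u)) <=
  \sum_(n.+1 <= i < (n + k).+1) sup_dist (f_ i) f.
Proof.
move=> cX f_comm; elim: k n => [|k IHk] n.
  by rewrite addn0 big_geq// mdistxx.
rewrite addnS -addSn.
apply: le_trans (metric_triangle _ (iter k f (nds_iter f_ n.+1 u)) _) _.
rewrite big_ltn ?ltnS ?addSn ?leqW ?leq_addr// addrC lerD//; last first.
  by rewrite -addSn; exact: IHk.
have /(congr1 (fun g => g (nds_iter f_ n u))) /= <- :=
  iter_comm k (f_comm n.+1 isT).
exact: mdist_le_sup_dist.
Qed.

(** One threshold [N] serves all later starting times [n], all lengths [k] and
    all points [u]: the transfer from the sequence to [f] has no control over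
    how far beyond [N] its starting time lies. *)
Lemma nds_iter_shadow e :
  compact [set: X] ->
  (forall i, Zplus i -> f_ i \o f = f \o f_ i) ->
  (\sum_(1 <= i <oo) (sup_dist (f_ i) f)%:E < +oo)%E ->
  0 < e ->
  exists N, forall n k u, (N <= n)%N ->
    mdist (nds_iter f_ (n + k)%N u) (iter k f (nds_iter f_ n u)) < e.
Proof.
move=> cX f_comm f_sum e0.
have D0 i : (0 <= (sup_dist (f_ i) f)%:E)%E by rewrite lee_fin sup_dist_ge0.
(* Convergence of tails is about series from [0]; the meaningless term of
   index [0] is finite. *)
have f_sum0 : (\sum_(0 <= i <oo) (sup_dist (f_ i) f)%:E < +oo)%E.
  by rewrite nneseries_recl// lte_add_pinfty// ltry.
have := nneseries_tail_cvg f_sum0 (fun i _ => D0 i).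
have e0E : (0 < e%:E)%E by rewrite lte_fin.
move=> /(_ _ (open_ereal_lt' e0E))[N _ NP].
exists N => n k u Nn.
apply: le_lt_trans (mdist_nds_iter_shift n k u cX f_comm) _.
rewrite -lte_fin -sumEFin; apply: le_lt_trans (NP n.+1 (leqW Nn)).
exact: nneseries_lim_ge.
Qed.

End nds_iter_theory.

(** The radius comes in two halves: one for the ball that orbits are required
    to hit, the other for the shadowing error. *)
Lemma open_sub_ball2 (R : realType) (X : metricType R) (V : set X) (v : X) :
  open V -> V v -> exists2 e : R, 0 < e & ball v (e + e) `<=` V.
Proof.
move=> oV Vv; have /nbhs_ballP[r /= r0 rV] : nbhs v V by exact: open_nbhs_nbhs.
by exists (r / 2); [rewrite divr_gt0 | rewrite -splitr].
Qed.

(** * Transfer of transitivity *)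

Section transfer.
Context {R : realType} {X : metricType R}.
Variables (f_ : nat -> X -> X) (f : X -> X) (F : set (set nat)).
Hypothesis compactX : compact [set: X].
Hypothesis f_comm : forall n, Zplus n -> f_ n \o f = f \o f_ n.
Hypothesis f_sum : (\sum_(1 <= i <oo) (sup_dist (f_ i) f)%:E < +oo)%E.
Hypothesis F_furstenberg : furstenberg_family F.
Hypothesis F_translation : translation_invariant F.

Lemma ads_transitive_nds :
  feeble_open_seq f_ -> ads_transitive F f -> nds_transitive F f_.
Proof.
move=> f_feeble f_tr U V oU oV U0 [v Vv].
have [e e0 eV] := open_sub_ball2 oV Vv.
have [N NP] := nds_iter_shadow compactX f_comm f_sum e0.
have FW : F (hitting_times f (interior (nds_iter f_ N.+1 @` U))
                             (interior (ball v e))).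
  apply: f_tr; [exact: open_interior | exact: open_interior | |].
    exact: nds_iter_feeble_open.
  by exists v; exact: nbhsx_ballx.
have [FNW _] := F_translation FW (isT : Zplus N.+1).
have [_ Fup _] := F_furstenberg.
apply: Fup FNW; first by move=> n [].
move=> _ [k [k0 [_ [[y yU <-] yv]]] <-]; split.
  by rewrite /Zplus /= addnS.
have [u Uu uy] := interior_subset yU.
exists (nds_iter f_ (k + N.+1)%N u); split; first by exists u.
apply: eV; apply: ball_triangle (interior_subset yv) _.
rewrite ballEmdist /= metric_sym addnC -uy.
exact: NP.
Qed.

Lemma nds_transitive_ads :
  (forall n, Zplus n -> continuous (f_ n)) ->
  nds_transitive F f_ -> ads_transitive F f.
Proof.
move=> f_cont f_tr U V oU oV U0 [v Vv].
have [e e0 eV] := open_sub_ball2 oV Vv.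
have [N NP] := nds_iter_shadow compactX f_comm f_sum e0.
have X0 : [set: X] !=set0 by exists v.
have [m [m0 [_ [[x _ <-] xU]]] Nm] := translation_invariant_unbounded N
  F_furstenberg F_translation (f_tr _ _ openT oU X0 U0).
have FW : F (nds_hitting_times f_ (nds_iter f_ m @^-1` U)
                                  (interior (ball v e))).
  apply: f_tr; [|exact: open_interior|by exists x|].
    by apply: open_comp oU => y _; exact: nds_iter_continuous.
  by exists v; exact: nbhsx_ballx.
have [_ FWm] := F_translation FW m0.
have [_ Fup _] := F_furstenberg.
apply: Fup FWm; first by move=> n [].
move=> k [[n [n0 [_ [[u uU <-] uv]]] nmk] k0]; split => //.
have mn : (m <= n)%N by apply: ltnW; rewrite -subn_gt0 nmk.
exists (iter k f (nds_iter f_ m u)); split; first by exists (nds_iter f_ m u).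
apply: eV; apply: ball_triangle (interior_subset uv) _.
rewrite ballEmdist /= -nmk -{1}(subnKC mn).
by apply: NP; exact: ltnW.
Qed.

End transfer.

Theorem theorem3p1 (R : realType) (X : metricType R)
    (compactX : compact [set: X])
    (f_ : nat -> X -> X) (f : X -> X)
    (f_cont : forall n, Zplus n -> continuous (f_ n))
    (f_feeble_open : feeble_open_seq f_)
    (fcont : continuous f)
    (f_comm : forall n, Zplus n -> f_ n \o f = f \o f_ n)
    (f_sum : (\sum_(1 <= i <oo) (sup_dist (f_ i) f)%:E < +oo)%E)
    (F : set (set nat))
    (F_furstenberg : furstenberg_family F)
    (F_filterdual : filterdual F)
    (F_translation : translation_invariant F) :
  ads_transitive F f <-> nds_transitive F f_.
Proof.
by split; [exact: ads_transitive_nds | exact: nds_transitive_ads].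
Qed.
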